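(* Let $k$ be a field and let $\mathcal{C}=kQ/I$ be a countable $k$-linear category of locally finite dimension, where $Q$ is a quiver and $I$ an admissible ideal. If $\mathcal{C}$ is a tree, then $HH^n(\mathcal{C})=0$ for all $n\geq 1$.
   Context: For a small $k$-linear category $\mathcal{C}$, $\mathcal{C}_0$ is its set of objects and ${}_y\mathcal{C}_x$ the space of morphisms from $x$ to $y$. $\mathcal{C}$ is countable if $\mathcal{C}_0$ is countable, and of locally finite dimension if every ${}_y\mathcal{C}_x$ is finite dimensional. For a (possibly infinite) quiver $Q$, $kQ$ is the $k$-linear path category: its objects are the vertices, and its morphism spaces have the paths as basis. An ideal $I$ of $kQ$ is admissible if $I\subseteq F^2$ and for every pair of vertices $x,y$ there is $N$ with ${}_y(F^N)_x\subseteq I$, where $F$ is the ideal generated by the arrows. The quiver associated to a $k$-linear category $\mathcal{C}$ has vertex set $\mathcal{C}_0$ and $\dim_k({}_y\mathrm{rad}(\mathcal{C})_x/{}_y\mathrm{rad}^2(\mathcal{C})_x)$ arrows from $x$ to $y$, $\mathrm{rad}$ being the Jacobson radical of the category. $\mathcal{C}$ is a tree if the underlying graph of its associated quiver has no cycles (in particular no loops or multiple edges). $HH^n(\mathcal{C})=H^n(\mathcal{C},\mathcal{C})$ is Hochschild-Mitchell cohomology, the cohomology of $C^n(\mathcal{C},\mathcal{C})=\prod_{(x_{n+1},\dots,x_1)}\mathrm{Hom}_k({}_{x_{n+1}}\mathcal{C}_{x_n}\otimes\cdots\otimes{}_{x_2}\mathcal{C}_{x_1},{}_{x_{n+1}}\mathcal{C}_{x_1})$,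 $C^0=\prod_x{}_x\mathcal{C}_x$, with the usual Hochschild differential. *)

(* Defs.v *)
From HB Require Import structures.
From mathcomp Require Import all_boot all_algebra finmap.
From mathcomp Require Import boolp classical_sets cardinality.
From mathcomp.multinomials Require Import monalg.

Set Implicit Arguments.
Unset Strict Implicit.
Unset Printing Implicit Defensive.

Import GRing.Theory.
Local Open Scope ring_scope.
Local Open Scope quotient_scope.
Local Open Scope classical_set_scope.

Lemma submod_setP (k : pzRingType) (V : lmodType k) (W : set V) :
  submod_closed [in W] <->
  W 0 /\ (forall a u v, W u -> W v -> W (a *: u + v)).
Proof.
split=> [[/set_mem W0 Wlin]|[W0 Wlin]]; split=> //.
- by move=> a u v Wu Wv; apply/set_mem/Wlin; apply/mem_set.
- exact/mem_set.
- by move=> a u v /set_mem Wu /set_mem Wv; apply/mem_set/Wlin.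
Qed.

(* Quotient of a module by a submodule: ring_quotient only provides the       *)
(* underlying Z-module.                                                       *)

Section LmodQuotient.
Variables (k : pzRingType) (V : lmodType k) (W : set V).
Hypothesis subW : submod_closed [in W].

Definition submod_pred of submod_closed [in W] : {pred V} := [in W].

HB.instance Definition _ := GRing.isSubmodClosed.Build k V (submod_pred subW)
  (GRing.submod_closed_semi subW).

Record submod := Submod { submod_val :> V; _ : submod_val \in submod_pred subW }.
HB.instance Definition _ := [isSub for submod_val].
HB.instance Definition _ := [Choice of submod by <:].
HB.instance Definition _ := [SubChoice_isSubLmodule of submod by <:].

Definition lmod_quot : Type := Quotient.quot (submod_pred subW).
HB.instance Definition _ := GRing.Zmodule.on lmod_quot.
HB.instance Definition _ := EqQuotient.on lmod_quot.

Definition lpi (v : V) : lmod_quot := \pi_lmod_quot v.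
Definition lrepr (u : lmod_quot) : V := repr u.

Lemma lreprK : cancel lrepr lpi.
Proof. exact: reprK. Qed.

Lemma lpiP (v w : V) : lpi v = lpi w <-> W (v - w).
Proof.
have e := Quotient.idealrBE (submod_pred subW) v w.
split=> [h|h]; last by apply/eqP; rewrite -e; apply/mem_set.
by apply/set_mem; rewrite -[_ \in _]/(_ \in submod_pred subW) e; apply/eqP.
Qed.

Lemma lpi_repr (v : V) : W (lrepr (lpi v) - v).
Proof. by apply/lpiP; rewrite lreprK. Qed.

Fact lpiD (v w : V) : lpi (v + w) = lpi v + lpi w.
Proof. exact: Quotient.pi_add. Qed.

Definition scaleq (a : k) (u : lmod_quot) : lmod_quot := lpi (a *: lrepr u).

Fact scaleq_pi a (v : V) : scaleq a (lpi v) = lpi (a *: v).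
Proof.
apply/lpiP; rewrite -scalerBr; apply/set_mem; have [W0 Wlin] := subW.
by rewrite -[_ *: _]addr0; apply: Wlin => //; apply/mem_set/lpi_repr.
Qed.

Fact scaleqA a b v : scaleq a (scaleq b v) = scaleq (a * b) v.
Proof.
by rewrite -[v]lreprK [scaleq b _]scaleq_pi !scaleq_pi scalerA.
Qed.

Fact scaleq1 : left_id 1 scaleq.
Proof. by move=> v; rewrite -[v]lreprK scaleq_pi scale1r. Qed.

Fact scaleqDr : right_distributive scaleq +%R.
Proof.
move=> a u v; rewrite -[u]lreprK -[v]lreprK -lpiD !scaleq_pi -lpiD.
by rewrite scalerDr.
Qed.

Fact scaleqDl v : {morph scaleq^~ v : a b / a + b}.
Proof. by move=> a b; rewrite -[v]lreprK !scaleq_pi -lpiD scalerDl. Qed.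

HB.instance Definition _ :=
  GRing.Zmodule_isLmodule.Build k lmod_quot scaleqA scaleq1 scaleqDr scaleqDl.

Lemma lpi_linear : linear lpi.
Proof. by move=> a u v; rewrite lpiD -scaleq_pi. Qed.

End LmodQuotient.

(* [Z / (Z \cap B)]; it is used for submodules [B] of [Z], but the inclusion   *)
(* is not required.                                                           *)

Section Subquotient.
Variables (k : pzRingType) (V : lmodType k) (Z B : set V).
Hypotheses (subZ : submod_closed [in Z]) (subB : submod_closed [in B]).

Fact subquot_submod : submod_closed [in [set z : submod subZ | B (val z)]].
Proof.
have [B0 Blin] := (submod_setP B).1 subB.
by apply/submod_setP; split=> //= a u v; exact: Blin.
Qed.

Definition subquot : lmodType k := lmod_quot subquot_submod.

End Subquotient.

Definition is_basis (k : fieldType) (V : lmodType k) (E : Type) (b : E -> V) :=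
  forall v : V,
    exists! c : {malg k[{classic E}]}, v = \sum_(e <- msupp c) c@_e *: b e.

Definition has_dim (k : fieldType) (V : lmodType k) (E : Type) : Prop :=
  exists b : E -> V, is_basis b.

(* [hom z y] is the space of morphisms from [y] to [z]; composition is        *)
(* written in the usual right-to-left order.                                  *)

Record lincat (k : fieldType) := LinCat {
  ob :> Type;
  hom : ob -> ob -> lmodType k;
  comp : forall z y x, hom z y -> hom y x -> hom z x;
  idm : forall x, hom x x;
  comp_linearl : forall z y x (f : hom y x), linear (fun g : hom z y => comp g f);
  comp_linearr : forall z y x (g : hom z y), linear (fun f : hom y x => comp g f);
  compA : forall w z y x (h : hom w z) (g : hom z y) (f : hom y x),
    comp h (comp g f) = comp (comp h g) f;
  comp1m : forall y x (f : hom y x), comp (idm y) f = f;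
  compm1 : forall y x (f : hom y x), comp f (idm x) = f
}.
Arguments hom {k} _ _ _.
Arguments comp {k _ _ _ _} _ _.
Arguments idm {k _} _.

Section LincatTheory.
Variables (k : fieldType) (C : lincat k).

HB.instance Definition _ (z y x : C) (g : hom C z y) :=
  GRing.isLinear.Build k (hom C y x) (hom C z x) *:%R (comp g)
    (comp_linearr (x:=x) g).

Lemma compBl (z y x : C) (g h : hom C z y) (f : hom C y x) :
  comp (g - h) f = comp g f - comp h f.
Proof. by rewrite addrC -scaleN1r comp_linearl scaleN1r addrC. Qed.

End LincatTheory.

Definition countable_cat (k : fieldType) (C : lincat k) : Prop :=
  countable [set: C].

Definition locally_finite_dim (k : fieldType) (C : lincat k) : Prop :=
  forall y x : C, exists n : nat, inhabited (Vector.axiom n (hom C y x)).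

Section Ideals.
Variables (k : fieldType) (C : lincat k).

Definition homset := forall y x : C, set (hom C y x).

Definition is_ideal (J : homset) : Prop :=
  [/\ forall y x, submod_closed [in J y x],
      forall z y x (g : hom C z y) (f : hom C y x), J y x f -> J z x (comp g f)
    & forall z y x (g : hom C z y) (f : hom C y x), J z y g -> J z x (comp g f)].

Definition generated_ideal (S : homset) : homset := fun y x =>
  [set f | forall J, is_ideal J -> (forall b a, S b a `<=` J b a) -> J y x f].

Definition ideal_prod (I J : homset) : homset := fun z x =>
  smallest (fun W : set (hom C z x) => submod_closed [in W])
    [set h | exists y (g : hom C z y) (f : hom C y x),
      [/\ I z y g, J y x f & h = comp g f]].

Fixpoint ideal_pow (J : homset) (n : nat) : homset :=
  if n is m.+1 then (if m is 0 then J else ideal_prod (ideal_pow J m) J)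
  else fun _ _ => setT.

Definition invertible (x : C) (u : hom C x x) : Prop :=
  exists v, comp v u = idm x /\ comp u v = idm x.

(* Kelly's description: the unique ideal whose component at each [x] is the  *)
(* Jacobson radical of the algebra [hom C x x].                               *)
Definition jacobson_radical : homset := fun y x =>
  [set f | forall g : hom C x y, invertible (idm x - comp g f)].

Fact jacobson_radical_submod y x : submod_closed [in jacobson_radical (y:=y) (x:=x)].
Proof.
apply/submod_setP; split=> [g|a f1 f2 J1 J2 g] /=.
  by exists (idm x); rewrite linear0 subr0 !comp1m.
have [u [uK Ku]] := J1 (a *: g); have [v [vK Kv]] := J2 (comp u g).
have fE : idm x - comp g (a *: f1 + f2) =
    comp (idm x - comp (a *: g) f1) (idm x - comp (comp u g) f2).
  rewrite linearB /= compm1 -compA compA Ku comp1m linearP opprD addrA.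
  have agf : comp (a *: g) f1 = a *: comp g f1.
    by rewrite -[a *: g]addr0 comp_linearl -(subrr 0) compBl subrr addr0.
  by rewrite agf.
exists (comp v u); rewrite fE; split.
  by rewrite -compA [comp u _]compA uK comp1m vK.
by rewrite -compA [comp _ (comp v u)]compA Kv comp1m Ku.
Qed.

Fact ideal_prod_submod I J y x : submod_closed [in ideal_prod I J (y:=y) (x:=x)].
Proof.
apply/submod_setP; split=> [W [/submod_setP[W0 _] _] //|a u v Ju Jv W hW].
by have [/submod_setP[_ Wlin] _] := hW; apply: Wlin; [exact: Ju|exact: Jv].
Qed.

End Ideals.
Arguments generated_ideal {k C} S y x _.
Arguments ideal_prod {k C} I J y x _.
Arguments ideal_pow {k C} J n y x _.
Arguments jacobson_radical {k} C y x _.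

Section QuotientCategory.
Variables (k : fieldType) (C : lincat k) (J : homset C).
Arguments J : clear implicits.
Hypothesis idJ : is_ideal J.

Fact ideal_submod (y x : C) : submod_closed [in J y x].
Proof. by case: idJ. Qed.

Definition qhom (y x : C) : lmodType k := lmod_quot (ideal_submod y x).

Definition qcomp z y x (g : qhom z y) (f : qhom y x) : qhom z x :=
  lpi _ (comp (lrepr g) (lrepr f)).

Lemma qcomp_pi z y x (g : hom C z y) (f : hom C y x) :
  qcomp (lpi _ g) (lpi _ f) = lpi _ (comp g f).
Proof.
have [_ Jl Jr] := idJ.
apply: (@eq_trans _ _ (lpi _ (comp (lrepr (lpi (ideal_submod z y) g)) f))).
  by apply/lpiP; rewrite -linearB; apply: Jl; apply: lpi_repr.
by apply/lpiP; rewrite -compBl; apply: Jr; apply: lpi_repr.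
Qed.

Fact qcomp_linearl z y x (f : qhom y x) : linear (fun g : qhom z y => qcomp g f).
Proof.
move=> a g h; rewrite -[f]lreprK -[g]lreprK -[h]lreprK.
by rewrite -lpi_linear !qcomp_pi comp_linearl lpi_linear.
Qed.

Fact qcomp_linearr z y x (g : qhom z y) : linear (fun f : qhom y x => qcomp g f).
Proof.
move=> a f h; rewrite -[f]lreprK -[g]lreprK -[h]lreprK.
by rewrite -lpi_linear !qcomp_pi comp_linearr lpi_linear.
Qed.

Fact qcompA w z y x (h : qhom w z) (g : qhom z y) (f : qhom y x) :
  qcomp h (qcomp g f) = qcomp (qcomp h g) f.
Proof. by rewrite -[f]lreprK -[g]lreprK -[h]lreprK !qcomp_pi compA. Qed.

Fact qcomp1m y x (f : qhom y x) : qcomp (lpi _ (idm y)) f = f.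
Proof. by rewrite -[f]lreprK qcomp_pi comp1m. Qed.

Fact qcompm1 y x (f : qhom y x) : qcomp f (lpi _ (idm x)) = f.
Proof. by rewrite -[f]lreprK qcomp_pi compm1. Qed.

Definition quotient_cat : lincat k :=
  LinCat qcomp_linearl qcomp_linearr qcompA qcomp1m qcompm1.

End QuotientCategory.

(* [arrow y x] is the type of arrows from [x] to [y], and [path y x] the type *)
(* of paths from [x] to [y].                                                  *)

Record quiver := Quiver { vertex : Type; arrow : vertex -> vertex -> Type }.
Arguments arrow : clear implicits.

Inductive path (Q : quiver) : vertex Q -> vertex Q -> Type :=
| pnil x : path x x
| pcons z y x of arrow Q z y & path y x : path z x.
Arguments pnil {Q} x.

Fixpoint pcat (Q : quiver) (z y x : vertex Q) (q : path z y) : path y x -> path z x :=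
  match q in path z y return path y x -> path z x with
  | pnil _ => id
  | pcons _ _ _ a q' => fun p => pcons a (pcat q' p)
  end.

Section PathCategory.
Variables (k : fieldType) (Q : quiver).

Definition phom (y x : vertex Q) : lmodType k := {malg k[{classic path y x}]}.

Definition pbasis y x (p : path y x) : phom y x := << (p : {classic path y x}) >>.

Definition pcomp z y x (g : phom z y) (f : phom y x) : phom z x :=
  \sum_(q <- msupp g) \sum_(p <- msupp f) (g@_q * f@_p) *: pbasis (pcat q p).

Lemma pcat1p y x (p : path y x) : pcat (pnil (Q := Q) y) p = p.
Proof. by []. Qed.

Lemma pcatp1 y x (p : path y x) : pcat p (pnil (Q := Q) x) = p.
Proof. by elim: p => //= ? ? ? a p ->. Qed.

Lemma pcatA w z y x (r : path w z) (q : path z y) (p : path (Q := Q) y x) :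
  pcat r (pcat q p) = pcat (pcat r q) p.
Proof. by elim: r q => //= ? ? ? a r IH q; rewrite IH. Qed.

Local Open Scope fset_scope.

Lemma pcompEw z y x (g : phom z y) (f : phom y x)
    (d1 : {fset {classic path z y}}) (d2 : {fset {classic path y x}}) :
  msupp g `<=` d1 -> msupp f `<=` d2 ->
  pcomp g f = \sum_(q <- d1) \sum_(p <- d2) (g@_q * f@_p) *: pbasis (pcat q p).
Proof.
move=> s1 s2; rewrite /pcomp (big_fset_incl _ s1) /=.
  apply: eq_bigr => q _; apply: big_fset_incl => // p _ /mcoeff_outdom ->.
  by rewrite mulr0 scale0r.
move=> q _ /mcoeff_outdom gq; rewrite big1 // => p _.
by rewrite gq mul0r scale0r.
Qed.

Fact pcomp_linearl z y x (f : phom y x) : linear (fun g : phom z y => pcomp g f).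
Proof.
move=> a g h; pose d := msupp g `|` msupp h.
have sg : msupp g `<=` d by apply: fsubsetUl.
have sh : msupp h `<=` d by apply: fsubsetUr.
have sgh : msupp (a *: g + h) `<=` d.
  exact: fsubset_trans (msuppD_le _ _) (fsetSU _ (msuppZ_le _ _)).
rewrite (pcompEw sg (fsubset_refl _)) (pcompEw sh (fsubset_refl _)).
rewrite (pcompEw sgh (fsubset_refl _)).
rewrite scaler_sumr -big_split; apply: eq_bigr => q _ /=.
rewrite scaler_sumr -big_split; apply: eq_bigr => p _ /=.
by rewrite scalerA -scalerDl mcoeffD mcoeffZ mulrDl mulrA.
Qed.

Fact pcomp_linearr z y x (g : phom z y) : linear (fun f : phom y x => pcomp g f).
Proof.
move=> a f h; pose d := msupp f `|` msupp h.
have sf : msupp f `<=` d by apply: fsubsetUl.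
have sh : msupp h `<=` d by apply: fsubsetUr.
have sfh : msupp (a *: f + h) `<=` d.
  exact: fsubset_trans (msuppD_le _ _) (fsetSU _ (msuppZ_le _ _)).
rewrite (pcompEw (fsubset_refl _) sf).
rewrite (pcompEw (fsubset_refl _) sh) (pcompEw (fsubset_refl _) sfh).
rewrite scaler_sumr -big_split; apply: eq_bigr => q _ /=.
rewrite scaler_sumr -big_split; apply: eq_bigr => p _ /=.
by rewrite scalerA -scalerDl mcoeffD mcoeffZ mulrDr mulrCA.
Qed.

Lemma phomE y x (f : phom y x) : f = \sum_(p <- msupp f) f@_p *: pbasis p.
Proof.
rewrite {1}[f]monalgE; apply: eq_bigr => p _; apply/malgP => q.
by rewrite mcoeffZ !mcoeffU mulrnAr mulr1.
Qed.

Lemma pcomp_basis z y x (q : path z y) (p : path y x) :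
  pcomp (pbasis q) (pbasis p) = pbasis (pcat q p).
Proof.
rewrite (pcompEw msuppU_le msuppU_le) !big_seq_fset1 !mcoeffUU.
by rewrite mulr1 scale1r.
Qed.

Lemma phom_ext y x (V : lmodType k) (F G : phom y x -> V) :
    linear F -> linear G -> (forall p, F (pbasis p) = G (pbasis p)) -> F =1 G.
Proof.
move=> linF linG FG f.
pose F' := HB.pack_for {linear phom y x -> V} F (GRing.isLinear.Build _ _ _ _ F linF).
pose G' := HB.pack_for {linear phom y x -> V} G (GRing.isLinear.Build _ _ _ _ G linG).
rewrite [f]phomE -[F]/(F' : _ -> _) -[G]/(G' : _ -> _) !linear_sum.
by apply: eq_bigr => p _; rewrite !linearZ /= FG.
Qed.

Fact pcompA w z y x (h : phom w z) (g : phom z y) (f : phom y x) :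
  pcomp h (pcomp g f) = pcomp (pcomp h g) f.
Proof.
move: h; apply: phom_ext => [a u v|a u v|r].
- by rewrite pcomp_linearl.
- by rewrite !pcomp_linearl.
move: g; apply: phom_ext => [a u v|a u v|q].
- by rewrite pcomp_linearl pcomp_linearr.
- by rewrite pcomp_linearr pcomp_linearl.
move: f; apply: phom_ext => [a u v|a u v|p].
- by rewrite !pcomp_linearr.
- by rewrite pcomp_linearr.
by rewrite !pcomp_basis pcatA.
Qed.

Fact pcomp1m y x (f : phom y x) : pcomp (pbasis (pnil y)) f = f.
Proof.
move: f; apply: phom_ext => [a u v|//|p]; first by rewrite pcomp_linearr.
by rewrite pcomp_basis.
Qed.

Fact pcompm1 y x (f : phom y x) : pcomp f (pbasis (pnil x)) = f.
Proof.
move: f; apply: phom_ext => [a u v|//|p]; first by rewrite pcomp_linearl.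
by rewrite pcomp_basis pcatp1.
Qed.

Local Close Scope fset_scope.

Definition path_cat : lincat k :=
  LinCat pcomp_linearl pcomp_linearr pcompA pcomp1m pcompm1.

Definition arrow_ideal : homset path_cat :=
  generated_ideal (C := path_cat)
    (fun y x => [set f | exists a : arrow Q y x, f = pbasis (pcons a (pnil x))]).

Arguments arrow_ideal : clear implicits.

Definition admissible (I : homset path_cat) : Prop :=
  (forall y x, I y x `<=` ideal_pow arrow_ideal 2 y x) /\
  (forall y x, exists N, ideal_pow arrow_ideal N y x `<=` I y x).

End PathCategory.
Arguments path_cat : clear implicits.
Arguments arrow_ideal : clear implicits.

(* [rad / rad^2] *)
Definition irr (k : fieldType) (C : lincat k) (y x : C) : lmodType k :=
  subquot (jacobson_radical_submod (C:=C) y x)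
    (ideal_prod_submod (jacobson_radical C) (jacobson_radical C) y x).

(* The quiver associated to [C] is only defined up to the choice, for each    *)
(* [y] and [x], of a set [A y x] of cardinality dim_k (rad / rad^2).          *)
Definition is_associated_quiver (k : fieldType) (C : lincat k)
    (A : C -> C -> Type) : Prop :=
  forall y x, has_dim (irr y x) (A y x).

Definition total_arrow (Q : quiver) :=
  {yx : vertex Q * vertex Q & arrow Q yx.1 yx.2}.

Definition joins (Q : quiver) (e : total_arrow Q) (u v : vertex Q) : Prop :=
  tag e = (u, v) \/ tag e = (v, u).

(* Cycles of the underlying unoriented multigraph, of length [n.+1]: those of *)
(* length 1 are loops, and those of length 2 are pairs of distinct parallel   *)
(* or opposite arrows.                                                        *)

Definition is_cycle (Q : quiver) (n : nat)
    (v : 'I_n.+1 -> vertex Q) (e : 'I_n.+1 -> total_arrow Q) : Prop :=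
  [/\ injective v, injective e & forall i, joins (e i) (v i) (v (ordS i))].

Definition acyclic (Q : quiver) : Prop :=
  forall n (v : 'I_n.+1 -> vertex Q) e, ~ is_cycle v e.

Definition is_tree (k : fieldType) (C : lincat k) : Prop :=
  exists A : C -> C -> Type, is_associated_quiver A /\ acyclic (Quiver A).

(* [chain n z x] is the type of sequences (f_n, ..., f_1) of composable       *)
(* morphisms from [x] to [z], over all sequences of intermediate objects.     *)

Section Hochschild.
Variables (k : fieldType) (C : lincat k).

Fixpoint chain (n : nat) (z x : C) : Type :=
  if n is m.+1 then {y : C & (hom C z y * chain m y x)%type} else z = x.

Definition ccons n z y x (f : hom C z y) (c : chain n y x) : chain n.+1 z x :=
  existT (fun y => (hom C z y * chain n y x)%type) y (f, c).

(* Multilinearity in (f_n, ..., f_1) stands for linearity on the tensor       *)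
(* product; chains of length 0 exist only for z = x, whence C^0.              *)
Fixpoint multilinear (V : lmodType k) n z x : (chain n z x -> V) -> Prop :=
  match n with
  | 0 => fun _ => True
  | m.+1 => fun phi => forall y,
      (forall c : chain m y x, linear (fun f : hom C z y => phi (ccons f c))) /\
      (forall f : hom C z y, multilinear (fun c : chain m y x => phi (ccons f c)))
  end.

Fact multilinear_submod (V : lmodType k) n z x (a : k) (phi psi : chain n z x -> V) :
  multilinear phi -> multilinear psi ->
  multilinear (fun c => a *: phi c + psi c).
Proof.
elim: n z x phi psi => //= n IH z x phi psi lphi lpsi y; split=> [c b f g|f].
  rewrite (lphi y).1 (lpsi y).1 !scalerDr !scalerA [b * a]mulrC.
  by rewrite -!addrA; congr (_ + _); rewrite addrCA.
by apply: IH; [exact: (lphi y).2|exact: (lpsi y).2].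
Qed.

Definition homfam n := forall z x : C, chain n z x -> hom C z x.

Section HomfamLmod.
Variable n : nat.
Implicit Types (phi psi : homfam n).

HB.instance Definition _ := gen_eqMixin (homfam n).
HB.instance Definition _ := gen_choiceMixin (homfam n).

Lemma homfamP phi psi : (forall z x c, phi z x c = psi z x c) -> phi = psi.
Proof. by move=> e; do 3![apply: functional_extensionality_dep => ?]. Qed.

Definition homfam0 : homfam n := fun _ _ _ => 0.
Definition homfamN phi : homfam n := fun z x c => - phi z x c.
Definition homfamD phi psi : homfam n := fun z x c => phi z x c + psi z x c.
Definition homfamZ (a : k) phi : homfam n := fun z x c => a *: phi z x c.

Fact homfamDA : associative homfamD.
Proof. by move=> *; apply: homfamP => *; exact: addrA. Qed.
Fact homfamDC : commutative homfamD.
Proof. by move=> *; apply: homfamP => *; exact: addrC. Qed.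
Fact homfam0D : left_id homfam0 homfamD.
Proof. by move=> *; apply: homfamP => *; exact: add0r. Qed.
Fact homfamND : left_inverse homfam0 homfamN homfamD.
Proof. by move=> *; apply: homfamP => *; exact: addNr. Qed.
HB.instance Definition _ :=
  GRing.isZmodule.Build (homfam n) homfamDA homfamDC homfam0D homfamND.

Fact homfamZA a b phi : homfamZ a (homfamZ b phi) = homfamZ (a * b) phi.
Proof. by apply: homfamP => *; exact: scalerA. Qed.
Fact homfam1Z : left_id 1 homfamZ.
Proof. by move=> *; apply: homfamP => *; exact: scale1r. Qed.
Fact homfamZDr : right_distributive homfamZ +%R.
Proof. by move=> *; apply: homfamP => *; exact: scalerDr. Qed.
Fact homfamZDl phi : {morph homfamZ^~ phi : a b / a + b}.
Proof. by move=> *; apply: homfamP => *; exact: scalerDl. Qed.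
HB.instance Definition _ :=
  GRing.Zmodule_isLmodule.Build k (homfam n) homfamZA homfam1Z homfamZDr homfamZDl.

End HomfamLmod.

(* The cochains form the subspace of [homfam n] of families of multilinear    *)
(* maps.                                                                      *)
Definition is_cochain n (phi : homfam n) : Prop := forall z x, multilinear (phi z x).

(* (f_n, ..., f_1) |-> ((f_n, ..., f_2), f_1)                                 *)
Fixpoint unsnoc n z x : chain n.+1 z x -> {y : C & (chain n z y * hom C y x)%type} :=
  match n with
  | 0 => fun c => let: existT y (f, e) := c in
      existT _ z (erefl z, ecast x (hom C z x) e f)
  | m.+1 => fun c => let: existT y (f, c') := c in
      let: existT w (c'', g) := unsnoc c' in existT _ w (ccons f c'', g)
  end.

(* Composes the morphisms in positions [j] and [j+1], counted from 0 at the   *)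
(* left.                                                                      *)
Fixpoint contract n (j : nat) z x {struct n} : chain n.+2 z x -> chain n.+1 z x :=
  fun c => let: existT y (f, existT w (g, c')) := c in
  match n, j return chain n w x -> chain n.+1 z x with
  | m.+1, i.+1 => fun c' => ccons f (contract i (ccons g c'))
  | _, _ => fun c' => ccons (comp f g) c'
  end c'.

Definition inner_faces n z x : (chain n z x -> hom C z x) -> chain n.+1 z x -> hom C z x :=
  match n with
  | 0 => fun _ _ => 0
  | m.+1 => fun phi c => \sum_(j < m.+1) (-1) ^+ j.+1 *: phi (contract j c)
  end.

Definition diff n (phi : homfam n) : homfam n.+1 := fun z x c =>
  (let: existT y (f, c') := c in comp f (phi y x c'))
  + inner_faces (phi z x) c
  + (-1) ^+ n.+1 *: (let: existT y (c', f) := unsnoc c in comp (phi z y c') f).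

Fact diff_linear n : linear (@diff n).
Proof.
move=> a phi psi; apply: homfamP => z x c.
have -> : (a *: diff phi + diff psi) z x c = a *: diff phi c + diff psi c by [].
rewrite /diff !scalerDr; case: (unsnoc c) => w [c2 g].
have -> : inner_faces ((a *: phi + psi) z x) c =
    a *: inner_faces (phi z x) c + inner_faces (psi z x) c.
  case: n phi psi c c2 => [|m] phi psi c c2 /=; first by rewrite scaler0 addr0.
  rewrite scaler_sumr -big_split; apply: eq_bigr => j _ /=.
  by rewrite scalerDr !scalerA mulrC.
case: c => y [f c'].
rewrite comp_linearr comp_linearl scalerDr !scalerA [a * _]mulrC.
rewrite [X in X + _ = _]addrACA [LHS]addrACA; reflexivity.
Qed.

Definition cocycles n : set (homfam n) :=
  [set phi | is_cochain phi /\ diff phi = 0].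

Definition coboundaries n : set (homfam n) :=
  match n with
  | 0 => [set 0]
  | m.+1 => [set diff psi | psi in @is_cochain m]
  end.

Fact is_cochain0 n : is_cochain (0 : homfam n).
Proof.
move=> z x; have : forall V : lmodType k, multilinear (fun _ : chain n z x => 0 : V).
  move=> V; elim: n z x => //= n IH z x y; split=> // c a f g.
  by rewrite scaler0 addr0.
exact.
Qed.

Fact is_cochainP n a (phi psi : homfam n) :
  is_cochain phi -> is_cochain psi -> is_cochain (a *: phi + psi).
Proof. by move=> cphi cpsi z x; exact: multilinear_submod. Qed.

HB.instance Definition _ n := GRing.isLinear.Build k (homfam n) (homfam n.+1) *:%R
  (@diff n) (@diff_linear n).

Fact cocycles_submod n : submod_closed [in @cocycles n].
Proof.
apply/submod_setP; split=> [|a phi psi [cphi dphi] [cpsi dpsi]].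
  by split; [exact: is_cochain0|rewrite linear0].
by split; [exact: is_cochainP|rewrite linearP /= dphi dpsi scaler0 addr0].
Qed.

Fact coboundaries_submod n : submod_closed [in @coboundaries n].
Proof.
apply/submod_setP; case: n => [|n] /=; split=> //.
- by move=> a _ _ -> ->; rewrite scaler0 addr0.
- by exists 0; [exact: is_cochain0|rewrite linear0].
- move=> a _ _ [phi cphi <-] [psi cpsi <-].
  by exists (a *: phi + psi); [exact: is_cochainP|rewrite linearP].
Qed.

Definition HH n : lmodType k := subquot (@cocycles_submod n) (@coboundaries_submod n).

End Hochschild.

(* Main.v *)
(* By admissibility the radical of C = kQ/I is generated by the arrows of Q,  *)
(* and these stay linearly independent in rad/rad^2.  So if C is a tree, then *)
(* Q has no cycles: parallel paths coincide, and a nonzero hom(y, x) is the   *)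
(* line spanned by the class of the only path from x to y.                    *)
(* A derivation scales every arrow; since closed walks in a forest have       *)
(* trivial holonomy, these scalars are differences of a potential, and the    *)
(* derivation is inner.  A cocycle phi of degree at least 2 is the            *)
(* differential of                                                            *)
(*    psi(p, c) = phi(1, p, c) - \sum_(p = u b v, b an arrow) u phi(b, v, c), *)
(* as in the hereditary algebra kQ; this makes sense modulo I because, in the *)
(* absence of parallel paths, the values of psi(p, -) lie in zero spaces when *)
(* p is in I.                                                                 *)

From HB Require Import structures.
From mathcomp Require Import all_boot all_algebra finmap zify.
From mathcomp Require Import boolp classical_sets.
From mathcomp.multinomials Require Import monalg.
Require Import Defs.

Set Implicit Arguments.
Unset Strict Implicit.
Unset Printing Implicit Defensive.

Import GRing.Theory.
Local Open Scope ring_scope.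
Local Open Scope classical_set_scope.

(** The argument separates a statement about [Q] from one about categories in which every hom space
    is spanned by the class of any path and vanishes when there is none. For the first,
    [tree_acyclic] maps the arrows of [Q] injectively, endpoints preserved, into an associated
    quiver without cycles. In a forest a nonempty closed walk must backtrack
    ([closed_walk_backtrack]); hence parallel paths coincide ([acyclic_path_unique]), and weights on
    arrows are differences of a potential ([exists_potential]). For the second, a 1-cocycle
    multiplies each arrow by a scalar, and a potential for these scalars makes it inner
    ([diff_onto_degree1]). In higher degree, expanding the first argument of phi arrow by arrow
    exhibits phi as the differential of [primitive] ([diff_primitive]); the expansion descends from
    paths to kQ/I by [split_sum_eq0]. *)

(** * Unoriented walks in a quiver without cycles *)

Section Walks.
Variable Q : quiver.

Definition to_total (y x : vertex Q) (a : arrow Q y x) : total_arrow Q :=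
  existT (fun yx => arrow Q yx.1 yx.2) (y, x) a.

Lemma to_total_inj y x : injective (@to_total y x).
Proof.
by move=> a b; apply: Eqdep_dec.inj_pair2_eq_dec => u v; exact: pselect.
Qed.

(* The boolean is [true] when the arrow is followed forwards.                 *)
Definition step : Type := (total_arrow Q * bool)%type.
Definition step_src (s : step) := if s.2 then (tag s.1).2 else (tag s.1).1.
Definition step_tgt (s : step) := if s.2 then (tag s.1).1 else (tag s.1).2.
Definition step_inv (s : step) : step := (s.1, ~~ s.2).

Lemma step_invK : involutive step_inv.
Proof. by case=> e b; rewrite /step_inv /= negbK. Qed.

Lemma step_src_inv s : step_src (step_inv s) = step_tgt s.
Proof. by case: s => e []. Qed.

Lemma step_tgt_inv s : step_tgt (step_inv s) = step_src s.
Proof. by case: s => e []. Qed.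

Fixpoint walk (x : vertex Q) (w : seq step) (y : vertex Q) : Prop :=
  if w is s :: w' then step_src s = x /\ walk (step_tgt s) w' y else x = y.

Lemma walk_cat x w1 w2 z :
  walk x (w1 ++ w2) z <-> exists2 y, walk x w1 y & walk y w2 z.
Proof.
elim: w1 x => [|s w1 IH] x /=; first by split=> [?|[y ->]//]; exists x.
split=> [[<- /IH[y ? ?]]|[y [<- ?] ?]]; first by exists y.
by split=> //; apply/IH; exists y.
Qed.

Definition walk_rev (w : seq step) := rev (map step_inv w).

Lemma walk_revP x w y : walk x w y -> walk y (walk_rev w) x.
Proof.
elim: w x => [|s w IH] x /=; first by move->.
move=> [<- /IH h]; rewrite /walk_rev /= rev_cons -cats1; apply/walk_cat.
by exists (step_tgt s) => //=; rewrite step_src_inv step_tgt_inv.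
Qed.

Lemma walk_tgt_nth s0 x w y i : walk x w y -> (i < size w)%N ->
  step_tgt (nth s0 w i) =
    if (i.+1 < size w)%N then step_src (nth s0 w i.+1) else y.
Proof.
elim: w x i => // s w IH x [|i] [_ h] /=.
  by case: w h {IH} => [|s' w] //= [->].
by rewrite ltnS => /(IH _ _ h).
Qed.

Lemma walk_src_head s0 x w y : walk x w y -> (0 < size w)%N ->
  step_src (nth s0 w 0) = x.
Proof. by case: w => // s w []. Qed.

(* A closed walk without repeated vertices is a cycle unless it uses an arrow *)
(* twice, which then happens at consecutive steps.                            *)
Lemma closed_walk_backtrack x w : acyclic Q -> walk x w x -> w <> [::] ->
  exists w1 s w2, w = w1 ++ s :: step_inv s :: w2.
Proof.
move=> acQ; have [n] := ubnP (size w); elim: n x w => // n IH x w.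
rewrite ltnS => sw xw w0.
have [s0 _] : exists s0 : step, True.
  by case: w w0 {sw xw} => [//|s0 ? _]; exists s0.
case sE: (size w) sw => [|m] sw; first by case: w0; apply: size0nil.
have [srcI|] := pselect (forall i j, (i < j < size w)%N ->
    step_src (nth s0 w i) <> step_src (nth s0 w j)); last first.
  (* A repeated source cuts out a shorter closed walk, to which induction applies. *)
  move=> /existsNP[i /existsNP[j /not_implyP[/andP[ij jw] /contrapT e]]].
  have wE : w = take i w ++ drop i (take j w) ++ drop j w.
    by rewrite catA -{1}(take_takel w (ltnW ij)) !cat_take_drop.
  have [|||w1 [s [w2 e2]]] := IH (step_src (nth s0 w i)) (drop i (take j w)).
  - by rewrite size_drop size_take jw; lia.
  - move: xw; rewrite {1}wE => /walk_cat[y1 _ /walk_cat[y2 h1 h2]].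
    have y1E : step_src (nth s0 w i) = y1.
      rewrite -(@walk_src_head s0 _ _ _ h1); last first.
        by rewrite size_drop size_take jw; lia.
      by rewrite nth_drop addn0 nth_take.
    have y2E : step_src (nth s0 w j) = y2.
      rewrite -(@walk_src_head s0 _ _ _ h2) ?size_drop ?subn_gt0 //.
      by rewrite nth_drop addn0.
    by rewrite {2}e y1E y2E.
  - by move=> /(congr1 size); rewrite size_drop size_take jw /=; lia.
  - by exists (take i w ++ w1), s, (w2 ++ drop j w); rewrite {1}wE e2 -!catA.
have srcI2 i j : (i < size w)%N -> (j < size w)%N ->
    step_src (nth s0 w i) = step_src (nth s0 w j) -> i = j.
  move=> iw jw e; have [ij|ji|//] := ltngtP i j.
    by case: (@srcI i j) => //; rewrite ij.
  by case: (@srcI j i) => //; rewrite ji.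
have iw (i : 'I_m.+1) : (i < size w)%N by rewrite sE.
apply: contrapT => nb; apply: (acQ m (fun i => step_src (nth s0 w i))
  (fun i => (nth s0 w i).1)); split=> [i j /srcI2 e|i j e|i].
- by apply/val_inj/e; apply: iw.
- apply/val_inj/eqP/negPn/negP => /eqP ij; apply: nb.
  wlog lij : i j e ij / (i < j)%N.
    move=> h; have [ij'|ji|//] := ltngtP i j; first exact: (h i j).
    by apply: (h j i) ji => //; exact: nesym.
  (* Using an arrow twice in the same direction would repeat a source, so step [j] inverts step [i].
     Its source is then the target of step [i], that is, the source of step [i.+1], and [j] is
     [i.+1]. *)
  have jE : nth s0 w j = step_inv (nth s0 w i).
    rewrite [nth _ _ j]surjective_pairing -e /step_inv; congr pair.
    case e2 : (nth s0 w j).2; case e1 : (nth s0 w i).2 => //; case: ij;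
    apply: srcI2; rewrite ?iw // /step_src e1 e2 e //.
  have := walk_tgt_nth s0 xw (iw i); rewrite -step_src_inv -jE.
  have h : (i.+1 < size w)%N by apply: leq_ltn_trans lij (iw j).
  rewrite h => /srcI2 jS; exists (take i w), (nth s0 w i), (drop j.+1 w).
  rewrite -jE -drop_nth ?iw// jS ?iw//.
  by rewrite -drop_nth ?iw// cat_take_drop.
- rewrite /joins; have := walk_tgt_nth s0 xw (iw i).
  have -> : (if (i.+1 < size w)%N then step_src (nth s0 w i.+1) else x) =
      step_src (nth s0 w (ordS i)).
    rewrite sE /=; have := ltn_ord i; rewrite leq_eqVlt => /orP[/eqP[e]|h].
      by rewrite e modnn ltnn (walk_src_head s0 xw) ?sE.
    by rewrite modn_small // ifT.
  move=> <-; case: (nth s0 w i) => e [] /=; rewrite /step_src /step_tgt /=.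
    by right; case: (tag e).
  by left; case: (tag e).
Qed.

(** * Holonomy and potentials *)

Section Potential.
Variables (V : zmodType) (lam : total_arrow Q -> V).

Definition holonomy (w : seq step) : V :=
  \sum_(s <- w) (if s.2 then lam s.1 else - lam s.1).

Lemma holonomy_cat w1 w2 : holonomy (w1 ++ w2) = holonomy w1 + holonomy w2.
Proof. exact: big_cat. Qed.

Lemma holonomy_rev w : holonomy (walk_rev w) = - holonomy w.
Proof.
rewrite /holonomy /walk_rev big_rev big_map.
by rewrite -sumrN; apply: eq_bigr => -[e []] _ //=; rewrite opprK.
Qed.

(** Deleting a backtrack leaves a shorter closed walk with the same holonomy. *)
Lemma closed_walk_holonomy x w : acyclic Q -> walk x w x -> holonomy w = 0.
Proof.
move=> acQ; have [n] := ubnP (size w); elim: n w => // n IH w.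
rewrite ltnS => sw xw; have [->|w0] := pselect (w = [::]).
  exact: big_nil.
have [w1 [s [w2 e]]] := closed_walk_backtrack acQ xw w0.
have h : holonomy w = holonomy (w1 ++ w2).
  rewrite e !holonomy_cat; congr (_ + _).
  rewrite -(cat1s s) -(cat1s (step_inv s)) catA holonomy_cat.
  rewrite /holonomy big_cons big_seq1.
  by case: s {e} => a [] /=; rewrite ?subrr ?addNr add0r.
rewrite h; apply: IH; first by move: sw; rewrite e !size_cat /=; lia.
move: xw; rewrite e => /walk_cat[y xy /= [sy [_]]].
rewrite step_tgt_inv sy => yx; apply/walk_cat; by exists y.
Qed.

(** The potential at x is the holonomy of a chosen walk from x to a root of its component. For an
    arrow from x to y, the closed walk from the root to x, along the arrow to y and back to the root
    has holonomy 0. *)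
Lemma exists_potential : acyclic Q ->
  exists t : vertex Q -> V, forall e, lam e = t (tag e).2 - t (tag e).1.
Proof.
move=> acQ; pose conn (x : vertex Q) : set {classic vertex Q} :=
  (fun y => exists w, walk x w y)%classic.
pose root (x : vertex Q) : vertex Q := xget (x : {classic vertex Q}) (conn x).
have rootP x : exists w, walk x w (root x).
  by apply: (@xgetPex {classic vertex Q} x (conn x)); exists x, [::].
have [t tP] := choice rootP; exists (fun x => holonomy (t x)) => e.
pose y := (tag e).1; pose x := (tag e).2; rewrite -/y -/x.
have rE : root x = root y.
  have cE : conn x = conn y.
    apply/funext => z; apply/propext; split=> -[w h].
      by exists ((e, false) :: w).
    by exists ((e, true) :: w).
  (* The two choices differ only in their default values, which would matter only for an empty
     component. *)
  rewrite /root /xget cE; case: pselect => // nex.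
  by exfalso; apply: nex; exists y; apply/asboolP; exists [::].
have h : walk (root x) (walk_rev (t x) ++ (e, true) :: t y) (root x).
  apply/walk_cat; exists x; first exact/walk_revP.
  by split=> //=; rewrite [X in walk _ _ X]rE.
have := closed_walk_holonomy acQ h.
rewrite holonomy_cat holonomy_rev -cat1s holonomy_cat {2}/holonomy big_seq1 /=.
by move=> /eqP; rewrite addrC subr_eq0 => /eqP <-; rewrite addrK.
Qed.

End Potential.

(** * Uniqueness of paths *)

(** A backtrack reverses the direction of travel, which here changes only between [u] and [v]. *)
Lemma turn_at_junction (u v w1 w2 : seq step) s :
  all snd u -> all (fun s => ~~ s.2) v ->
  u ++ v = w1 ++ s :: step_inv s :: w2 ->
  exists u' v', u = rcons u' s /\ v = step_inv s :: v'.
Proof.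
move=> + fv; elim: u w1 => [|c u IH] [|c1 w1] /=.
- by move=> _ e; move: fv; rewrite e /= negbK => /and3P[/negP].
- move=> _ e; move: fv; rewrite e /= all_cat /= negbK.
  by case/and5P=> _ _ /negP.
- move=> /andP[cs us] [ec]; case: u us {IH} => [|c' u] /=.
    by rewrite ec => _ ->; exists [::], w2.
  by move=> /andP[h _] [e _]; move: cs h; rewrite e ec /= => ->.
- move=> /andP[_ us] [_ /(IH _ us)[u' [v' [-> ->]]]].
  by exists (c :: u'), v'.
Qed.

(** The reverse of [w1] followed by [w2] is closed and can backtrack only at [y], so both walks
    begin with the same step. *)
Lemma directed_walk_unique y w1 w2 x : acyclic Q ->
  all (fun s => ~~ s.2) w1 -> all (fun s => ~~ s.2) w2 ->
  walk y w1 x -> walk y w2 x -> w1 = w2.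
Proof.
move=> acQ; elim: w1 y w2 => [|s1 w1 IH] y w2 d1 d2 h1 h2.
  apply: contrapT => /nesym w20; move: h2; rewrite -h1 => h2.
  have [v1 [s [v2 e]]] := closed_walk_backtrack acQ h2 w20.
  by have [] := turn_at_junction (u := [::]) isT d2 e => -[|? ?] [? []].
have h : walk x (walk_rev (s1 :: w1) ++ w2) x.
  by apply/walk_cat; exists y => //; apply: walk_revP.
have [|v1 [s [v2 e]]] := closed_walk_backtrack acQ h.
  by move=> /(congr1 size); rewrite size_cat size_rev.
have du : all snd (walk_rev (s1 :: w1)) by rewrite all_rev all_map.
have [u [w2' [+ w2E]]] := turn_at_junction du d2 e.
rewrite /walk_rev /= rev_cons => /rcons_inj[_ s1E].
move: d1 d2 h1 h2; rewrite w2E -s1E step_invK /= => /andP[_ d1] /andP[_ d2].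
by move=> [_ h1] [_ h2]; rewrite (IH (step_tgt s1) w2').
Qed.

(** A path is built from its target, so its arrows are met against their direction. *)
Fixpoint backward_steps (y x : vertex Q) (p : path y x) : seq step :=
  match p with
  | pnil _ => [::]
  | pcons z y x a p' => (to_total a, false) :: backward_steps p'
  end.

Lemma backward_stepsP y x (p : path y x) :
  all (fun s => ~~ s.2) (backward_steps p) /\ walk y (backward_steps p) x.
Proof. by elim: p => //= z y' x' a p [? ?]. Qed.

(** Packing the endpoints allows paths to be compared when their endpoints are only provably
    equal. *)
Let tpath := {yx : vertex Q * vertex Q & path yx.1 yx.2}.
Let Tpath y x (p : path y x) : tpath := existT _ (y, x) p.

Lemma Tpath_inj y x : injective (@Tpath y x).
Proof.
move=> p q; apply: (@Eqdep_dec.inj_pair2_eq_dec) => u v.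
exact: pselect.
Qed.

Lemma backward_steps_inj y x (p : path y x) y' x' (q : path y' x') :
  y = y' -> x = x' -> backward_steps p = backward_steps q -> Tpath p = Tpath q.
Proof.
have pconsE (e e' : total_arrow Q) u (r : path (tag e).2 u) u'
    (r' : path (tag e').2 u') : e = e' -> Tpath r = Tpath r' ->
    Tpath (pcons (tagged e) r) = Tpath (pcons (tagged e') r').
  move=> ee; case: e' / ee r' => r' rr.
  have uu : u = u' by have := congr1 (fun t : tpath => (tag t).2) rr.
  by case: u' / uu r' rr => r' /Tpath_inj ->.
elim: p y' x' q => [u|z y1 u a p IH] y' x' [u'|z' y1' u' b q] //=.
  by move=> _ ->.
pose e := to_total a; pose e' := to_total b.
move=> _ uu' pq; have ee : e = e' := congr1 (fun w => (head (e, false) w).1) pq.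
have yy : y1 = y1' := congr1 (fun e0 : total_arrow Q => (tag e0).2) ee.
exact: (pconsE e e' _ p _ q ee (IH _ _ _ yy uu' (congr1 behead pq))).
Qed.

Lemma acyclic_path_unique (y x : vertex Q) (p q : path y x) :
  acyclic Q -> p = q.
Proof.
move=> acQ; apply/Tpath_inj/backward_steps_inj => //.
have [dp hp] := backward_stepsP p; have [dq hq] := backward_stepsP q.
exact: directed_walk_unique hp hq.
Qed.
End Walks.

(** * Quotients, subquotients and bases *)

HB.instance Definition _ (k : pzRingType) (V : lmodType k) (W : set V)
    (subW : submod_closed [in W]) :=
  GRing.isLinear.Build k V (lmod_quot subW) *:%R (lpi subW) (lpi_linear subW).

Section SubquotientTheory.
Variables (k : pzRingType) (V : lmodType k) (Z B : set V).
Hypotheses (subZ : submod_closed [in Z]) (subB : submod_closed [in B]).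

Definition subquot_pi (z : submod subZ) : subquot subZ subB :=
  lpi (subquot_submod subZ subB) z.

Lemma subquot_pi_eq0 z : subquot_pi z = 0 <-> B (val z).
Proof.
rewrite -(linear0 (lpi (subquot_submod subZ subB))).
by split=> [/lpiP|h]; [rewrite subr0|apply/lpiP; rewrite subr0].
Qed.

Lemma subquot_pi_lincomb a b (u v : submod subZ) :
  a *: subquot_pi u + b *: subquot_pi v = subquot_pi (a *: u + b *: v).
Proof. by rewrite /subquot_pi linearD !linearZ. Qed.

End SubquotientTheory.

Section Basis.
Variables (k : fieldType) (V : lmodType k) (E : Type) (b : E -> V).
Hypothesis bP : is_basis b.

Lemma basis_empty_eq0 : (E -> False) -> forall v : V, v = 0.
Proof. by move=> nE v; have [c [-> _]] := bP v; rewrite big1 // => e /nE. Qed.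

Lemma basis_singleton_line : (forall e e' : E, e = e') ->
  exists w, forall v : V, exists s, v = s *: w.
Proof.
move=> E1; have [[e0]|nE] := pselect (inhabited E); last first.
  exists 0 => v; exists 0; rewrite scaler0; apply: basis_empty_eq0 => e.
  by apply: nE; exists.
exists (b e0) => v; have [c [-> _]] := bP v; exists (\sum_(e <- msupp c) c@_e).
by rewrite scaler_suml; apply: eq_bigr => e _; rewrite (E1 e e0).
Qed.

End Basis.

(** * The filtration of kQ by path length *)

Section PathLength.
Variables (k : fieldType) (Q : quiver).
Local Notation kQ := (path_cat k Q).

Fixpoint path_length (y x : vertex Q) (p : path y x) : nat :=
  if p is pcons _ _ _ _ p' then (path_length p').+1 else 0.

Lemma path_length_cat (z y x : vertex Q) (q : path z y) (p : path y x) :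
  path_length (pcat q p) = (path_length q + path_length p)%N.
Proof. by elim: q p => //= ? ? ? a q IH p; rewrite IH. Qed.

(** An upper bound for the power F^n of the arrow ideal that can be tested on coefficients. *)
Definition length_ge (n : nat) : homset kQ := fun y x =>
  [set f : phom k y x | forall p : path y x, (path_length p < n)%N ->
    f@_(p : {classic path y x}) = 0].
Arguments length_ge n y x _ : clear implicits.

Lemma length_ge_submod n y x : submod_closed [in length_ge n y x].
Proof.
apply/submod_setP; split=> [p _|a u v lu lv p pn]; first by rewrite mcoeff0.
by rewrite mcoeffD mcoeffZ lu // lv // mulr0 addr0.
Qed.

Lemma length_ge_comp m n z y x (g : hom kQ z y) (f : hom kQ y x) :
  length_ge m z y g -> length_ge n y x f -> length_ge (m + n) z x (comp g f).
Proof.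
move=> lg lf r rn; rewrite /= /pcomp raddf_sum big1 // => q _.
rewrite raddf_sum big1 // => p _ /=; rewrite mcoeffZ mcoeffU.
case: eqP => [e|_]; last by rewrite mulr0.
move: rn; rewrite -e path_length_cat => rn.
have [qm|mq] := ltnP (path_length q) m; first by rewrite lg // !mul0r.
by rewrite lf ?mulr0 ?mul0r //; lia.
Qed.

Lemma length_ge_leq m n y x : (m <= n)%N ->
  length_ge n y x `<=` length_ge m y x.
Proof. by move=> mn f lf p pm; apply: lf; apply: leq_trans mn. Qed.

Lemma length_ge_ideal n : is_ideal (length_ge n).
Proof.
split=> [y x|z y x g f lf|z y x g f lg]; first exact: length_ge_submod.
  by rewrite -(add0n n); apply: length_ge_comp.
by rewrite -(addn0 n); apply: length_ge_comp.
Qed.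

Lemma arrow_ideal_length y x : arrow_ideal k Q y x `<=` length_ge 1 y x.
Proof.
move=> f; apply; first exact: length_ge_ideal.
move=> b a _ [c ->] p; rewrite ltnS leqn0 => /eqP p0.
by rewrite mcoeffU; case: eqP => // pE; move: p0; rewrite -pE.
Qed.

Lemma ideal_prod_length m n (I J : homset kQ) :
  (forall y x, I y x `<=` length_ge m y x) ->
  (forall y x, J y x `<=` length_ge n y x) ->
  forall y x, ideal_prod I J y x `<=` length_ge (m + n) y x.
Proof.
move=> Im Jn y x f; apply; split; first exact: length_ge_submod.
by move=> _ [z [g [h [/Im Ig /Jn Jh ->]]]]; apply: length_ge_comp.
Qed.

Lemma generated_ideal_ideal (S : homset kQ) : is_ideal (generated_ideal S).
Proof.
split=> [y x|z y x g f Sf J idJ SJ|z y x g f Sg J idJ SJ].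
- apply/submod_setP; split=> [J [+ _ _] _|a u v Su Sv J idJ SJ].
    by move=> /(_ y x)/submod_setP[].
  have [/(_ y x)/submod_setP[_ h] _ _] := idJ.
  by apply: h; [exact: Su|exact: Sv].
- by have [_ h _] := idJ; apply: h; apply: Sf.
- by have [_ _ h] := idJ; apply: h; apply: Sg.
Qed.

End PathLength.
Arguments length_ge {k Q} n y x _.

(** * Linearity of composition and nilpotent endomorphisms *)

Section CompLinear.
Variables (k : fieldType) (C : lincat k) (z y x : C).
Implicit Types (g h : hom C z y) (f : hom C y x).

Lemma compDl g h f : comp (g + h) f = comp g f + comp h f.
Proof. by rewrite -[g]scale1r comp_linearl !scale1r. Qed.

Lemma comp0l f : comp (0 : hom C z y) f = 0.
Proof. by apply: (addrI (comp 0 f)); rewrite -compDl !addr0. Qed.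

Lemma compZl a g f : comp (a *: g) f = a *: comp g f.
Proof. by rewrite -[a *: g]addr0 comp_linearl comp0l addr0. Qed.

End CompLinear.

Section Nilpotent.
Variables (k : fieldType) (C : lincat k) (x : C) (h : hom C x x).

Fixpoint endo_pow (n : nat) : hom C x x :=
  if n is m.+1 then comp (endo_pow m) h else idm x.

Lemma endo_powSr n : endo_pow n.+1 = comp h (endo_pow n).
Proof.
elim: n => [|n IH] /=; first by rewrite comp1m compm1.
by rewrite compA -IH.
Qed.

(** The inverse is the finite geometric series. *)
Lemma nilpotent_invertible n : endo_pow n = 0 -> invertible (idm x - h).
Proof.
move=> h0; exists (\sum_(i < n) endo_pow i).
suff [-> ->] :
    comp (\sum_(i < n) endo_pow i) (idm x - h) = idm x - endo_pow n /\
    comp (idm x - h) (\sum_(i < n) endo_pow i) = idm x - endo_pow n.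
  by rewrite h0 subr0.
elim: n {h0} => [|n [IHl IHr]].
  rewrite big_ord0 linear0 /= subrr; split=> //.
  exact: comp0l.
rewrite big_ord_recr /=; split.
  by rewrite compDl IHl linearB /= compm1 addrA subrK.
by rewrite linearD /= IHr compBl comp1m -endo_powSr addrA subrK.
Qed.

End Nilpotent.

(** * The radical of kQ/I, and why Q is a forest *)

Section Admissible.
Variables (k : fieldType) (Q : quiver) (I : homset (path_cat k Q)).
Arguments I : clear implicits.
Variable idI : is_ideal I.
Local Notation kQ := (path_cat k Q).
Local Notation C := (quotient_cat idI).
Local Notation qpi := (lpi (ideal_submod idI _ _)).

Lemma qcomp_lpi (z y x : vertex Q) (g : hom kQ z y) (f : hom kQ y x) :
  comp (qpi g : hom C z y) (qpi f : hom C y x) = qpi (comp g f).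
Proof. exact: qcomp_pi. Qed.

Lemma lpi_endo_pow (x : vertex Q) (h : hom kQ x x) n :
  endo_pow (qpi h : hom C x x) n = qpi (endo_pow h n).
Proof. by elim: n => //= n ->; exact: qcomp_lpi. Qed.

Definition arrow_path (y x : vertex Q) (a : arrow Q y x) : path y x :=
  pcons a (pnil x).

Hypothesis admI : admissible I.

Lemma admissible_length y x : I y x `<=` length_ge 2 y x.
Proof.
move=> f /admI.1; apply: (@ideal_prod_length k Q 1 1);
  exact: arrow_ideal_length.
Qed.

(** For every g the endomorphism g a lies in F, so by admissibility some power of it lies in I: it
    is nilpotent in kQ/I, and 1 - g a is invertible. *)
Lemma arrow_radical (y x : vertex Q) (a : arrow Q y x) :
  jacobson_radical C y x (qpi (pbasis k (arrow_path a))).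
Proof.
move=> g; rewrite -[g]lreprK qcomp_lpi.
set h := comp _ _; have Fid := generated_ideal_ideal.
have Fh : arrow_ideal k Q x x h.
  have [_ Fl _] : is_ideal (arrow_ideal k Q) by exact: Fid.
  by apply: Fl => J _; apply; exists a.
have Fhn n : ideal_pow (arrow_ideal k Q) n x x (endo_pow h n).
  elim: n => [|[|n] IH] //.
    by rewrite endo_powSr /= pcompm1.
  by move=> W [_]; apply; exists x, (endo_pow h n.+1), h.
have [N FI] := admI.2 x x; apply: (@nilpotent_invertible _ _ _ _ N).
rewrite lpi_endo_pow; apply: (etrans (y := qpi 0)).
  by apply/lpiP; rewrite subr0; apply/FI/Fhn.
by apply: (addrI (qpi 0)); rewrite -lpiD !addr0.
Qed.

Lemma path_length0 (y x : vertex Q) (p : path y x) : path_length p = 0 ->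
  exists e : x = y, p = eq_rect x (fun y => path y x) (pnil x) y e.
Proof. by case: p => // u _; exists erefl. Qed.

Lemma loop_length0 (x : vertex Q) (p : path x x) : path_length p = 0 ->
  p = pnil x.
Proof. by move=> /path_length0[e ->]; rewrite (Prop_irrelevance e erefl). Qed.

(** Since I lies in length at least 2, coefficients on paths of length at most 1 do not depend on
    the representative. *)
Lemma lrepr_lpi_length (y x : vertex Q) (n : nat) (f : hom kQ y x) :
  (n <= 2)%N ->
  length_ge n y x (lrepr (qpi f)) <-> length_ge n y x f.
Proof.
move=> n2; have h : length_ge n y x (lrepr (qpi f) - f).
  by apply: length_ge_leq n2 _ _; apply: admissible_length; exact: lpi_repr.
have /submod_setP[_ lin] := @length_ge_submod k Q n y x.
split=> l.
  by have := lin (-1) _ _ h l; rewrite scaleN1r opprB subrK.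
by have := lin 1 _ _ h l; rewrite scale1r subrK.
Qed.

(** If the trivial path had coefficient c nonzero in f, then 1 - f / c would have a representative u
    without trivial path. For no v could v u - 1 lie in I, as its coefficient on the trivial path is
    -1. *)
Lemma radical_length (y x : vertex Q) (f : hom C y x) :
  jacobson_radical C y x f -> length_ge 1 y x (lrepr f).
Proof.
move=> Jf p; rewrite ltnS leqn0 => /eqP /path_length0[e].
case: y / e f Jf p => f Jf p -> /=.
apply: contrapT => /eqP; set c := _@__ => c0.
have [v [+ _]] := Jf (qpi (c^-1 *: pbasis k (pnil x))).
pose u : hom kQ x x := pbasis k (pnil x) - c^-1 *: lrepr f.
have -> : idm (x : C) - comp (qpi (c^-1 *: pbasis k (pnil x)) : hom C x x) f =
    qpi u.
  by rewrite -[f in LHS]lreprK qcomp_lpi compZl comp1m /u linearB.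
have u1 : length_ge 1 x x u.
  move=> q; rewrite ltnS leqn0 => /eqP /loop_length0 ->.
  by rewrite mcoeffB mcoeffZ mcoeffUU mulVf ?subrr.
rewrite -[v]lreprK qcomp_lpi => /lpiP/(@admissible_length _ _) vu.
have v0 : length_ge 0 x x (lrepr v) by [].
move: (vu (pnil x) isT); rewrite mcoeffB mcoeffUU (length_ge_comp v0 u1) //.
by rewrite sub0r => /eqP; rewrite oppr_eq0 oner_eq0.
Qed.

Lemma radical_square_length (y x : vertex Q) (f : hom C y x) :
  ideal_prod (jacobson_radical C) (jacobson_radical C) y x f ->
  length_ge 2 y x (lrepr f).
Proof.
move=> /(_ (fun f => length_ge 2 y x (lrepr f))); apply; split.
  have /submod_setP[l0 lin] := @length_ge_submod k Q 2 y x.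
  apply/submod_setP; split=> [|a u v lu lv].
    rewrite -(linear0 (lpi (ideal_submod idI y x))).
    exact/lrepr_lpi_length.
  rewrite -[u]lreprK -[v]lreprK -lpi_linear; apply/lrepr_lpi_length => //.
  exact: lin.
move=> _ [z [g [h [/radical_length lg /radical_length lh ->]]]].
rewrite -[g]lreprK -[h]lreprK qcomp_lpi; apply/lrepr_lpi_length => //.
exact: (length_ge_comp (m := 1) (n := 1)).
Qed.

Definition irr_arrow (y x : vertex Q) (a : arrow Q y x) :
    @irr k C y x :=
  subquot_pi _ (Submod (mem_set (arrow_radical a))).

(** Elements of rad^2 have no coefficient on paths of length 1. The premise on [t] covers two uses
    at once: an arrow is nonzero in rad/rad^2 ([a = b], [t = 0]), and two distinct arrows are
    independent. *)
Lemma irr_arrow_free (y x : vertex Q) (a b : arrow Q y x) s t :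
  (a = b -> t = 0) ->
  s *: irr_arrow a + t *: irr_arrow b = 0 -> s = 0.
Proof.
move=> ab h.
pose f := s *: pbasis k (arrow_path a) + t *: pbasis k (arrow_path b).
have : length_ge 2 y x (lrepr (qpi f : hom C y x)).
  apply: radical_square_length.
  move: h; rewrite /irr_arrow subquot_pi_lincomb => /subquot_pi_eq0.
  suff <- : s *: qpi (pbasis k (arrow_path a)) +
      t *: qpi (pbasis k (arrow_path b)) = qpi f by [].
  by rewrite linearD !linearZ.
move=> /lrepr_lpi_length -/(_ isT) /(_ (arrow_path a) isT).
rewrite mcoeffD !mcoeffZ mcoeffUU mcoeffU.
case: eqP => [e|_]; last by rewrite mulr1 mulr0 addr0.
rewrite mulr1 ab ?mul0r ?addr0 //.
apply/esym/to_total_inj.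
exact: (congr1 (fun p => (head (to_total a, false) (backward_steps p)).1) e).
Qed.

(** [A] has no loops and no parallel arrows, so rad/rad^2 has dimension at most 1 between any two
    objects. As the arrows of [Q] are independent there, each is alone between its endpoints and has
    a counterpart in [A]; a cycle of [Q] would thus give one of [A]. *)
Lemma tree_acyclic : is_tree C -> acyclic Q.
Proof.
move=> [A [basisA acA]].
pose QA := Quiver A.
have Aloop (x : C) : A x x -> False.
  move=> a; apply: (acA 0 (fun=> x) (fun=> to_total (Q := QA) a)).
  by split=> [i j _|i j _|i]; rewrite ?ord1 //; left.
have Auniq (y x : C) (a b : A y x) : a = b.
  apply: contrapT => ab;
  have yx : y <> x by move=> e; case: x / e a {b ab} => /Aloop.
  pose arr (c : A y x) := to_total (Q := QA) c.
  apply: (acA 1 (fun i => if i == ord0 then y else x)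
               (fun i => if i == ord0 then arr a else arr b)); split.
  - by case=> -[|[|?]] ? [[|[|?]] ?] //= e; apply/val_inj => //; case: yx.
  - have arrab : arr a <> arr b by move=> /to_total_inj.
    by case=> -[|[|?]] ? [[|[|?]] ?] //= e; apply/val_inj => //; case: arrab.
  - by case=> -[|[|?]] ? //=; [left|right].
have arrA (e : total_arrow Q) : exists e' : total_arrow QA, tag e' = tag e.
  case: e => -[y x] a; have [b bP] := basisA y x.
  suff [a'] : inhabited (A y x) by exists (to_total (Q := QA) a').
  apply: contrapT => nA; have /eqP := oner_neq0 k; apply.
  apply: (@irr_arrow_free _ _ a a 1 0) => //.
  by apply: (basis_empty_eq0 bP) => a'; apply: nA.
have [F tagF] := choice arrA.
have Finj : injective F.
  move=> e e' Fe; have : tag e = tag e' by rewrite -!tagF Fe.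
  case: e {Fe} => -[y x] a; case: e' => -[y' x'] a' /= [ey ex].
  case: y' / ey a'; case: x' / ex => a'.
  congr existT; apply: contrapT => aa'.
  have [b bP] := basisA y x.
  have [w wP] := basis_singleton_line bP (@Auniq y x).
  have [s sP] := wP (irr_arrow a); have [t tP] := wP (irr_arrow a').
  (* Both arrows lie on the line of [w], with coordinates [s] and [t]; the relation t a - s a' = 0
     contradicts independence unless [t = 0], and then a' would vanish. *)
  have t0 : t = 0.
    apply: (@irr_arrow_free _ _ a a' t (- s)) => [/aa'//|].
    by rewrite sP tP !scalerA mulNr scaleNr mulrC subrr.
  have /eqP := oner_neq0 k; apply.
  apply: (@irr_arrow_free _ _ a' a 1 0) => //.
  by rewrite tP t0 !scale0r scaler0 addr0.
move=> n v e [vI eI ve]; apply: (acA n v (F \o e)); split=> // [i j|i].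
  by move=> /Finj/eI.
by have := ve i; rewrite /joins /= tagF.
Qed.

End Admissible.

(** * The Hochschild differential without its first term *)

Section ReducedDifferential.
Variables (k : fieldType) (C : lincat k).

(* The terms of the Hochschild differential other than the first one. They    *)
(* do not need the target of the values to be that of the arguments.          *)
Definition rdiff n (z y : C) (th : forall x, chain n y x -> hom C z x)
    (x : C) (c : chain n.+1 y x) : hom C z x :=
  match n return (forall x, chain n y x -> hom C z x) ->
      chain n.+1 y x -> hom C z x with
  | 0 => fun _ _ => 0
  | m.+1 => fun th c => \sum_(j < m.+1) (-1) ^+ j.+1 *: th x (contract j c)
  end th c
  + (-1) ^+ n.+1 *: (let: existT w (c', f) := unsnoc c in comp (th w c') f).

Lemma diff_ccons n (phi : homfam C n) z y x (f : hom C z y) (c : chain n y x) :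
  diff phi (ccons f c) = comp f (phi y x c) + rdiff (phi z) (ccons f c).
Proof. by rewrite /diff /rdiff addrA; case: n phi c. Qed.

(** Splitting off the first contraction shifts the remaining positions by one, hence the sign. This
    recursion replaces all later computations with indexed sums. *)
Lemma rdiff_ccons n (v z y w x : C) (th : forall x, chain n.+1 z x -> hom C v x)
    (f : hom C z y) (g : hom C y w) (c : chain n w x) :
  rdiff th (ccons f (ccons g c)) = - th x (ccons (comp f g) c)
    - rdiff (fun x c => th x (ccons f c)) (ccons g c).
Proof.
rewrite /rdiff big_ord_recl expr1 scaleN1r opprD addrA -[LHS]addrA -[RHS]addrA.
congr (_ + _); first by case: n th c.
congr (_ + _).
  case: n th c => [|n] th c; first by rewrite big_ord0 oppr0.
  rewrite -sumrN; apply: eq_bigr => j _.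
  by rewrite exprS mulN1r scaleNr.
rewrite exprS mulN1r scaleNr; congr (- (_ *: _)).
by rewrite /=; case: (unsnoc _) => u [c' h].
Qed.

Lemma rdiffD n (z y x : C) (th ze : forall x, chain n y x -> hom C z x) c :
  rdiff (x := x) (fun x c => th x c + ze x c) c = rdiff th c + rdiff ze c.
Proof.
rewrite /rdiff; case: (unsnoc c) => w [c' f].
rewrite compDl scalerDr addrACA; congr (_ + _).
case: n th ze c c' => [|n] th ze c c'; first by rewrite addr0.
by rewrite -big_split; apply: eq_bigr => j _; rewrite scalerDr.
Qed.

Lemma rdiff_comp n (v z y x : C) (g : hom C v z)
    (th : forall x, chain n y x -> hom C z x) c :
  rdiff (x := x) (fun x c => comp g (th x c)) c = comp g (rdiff th c).
Proof.
rewrite /rdiff; case: (unsnoc c) => w [c' f].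
rewrite linearD linearZ /= compA; congr (_ + _).
case: n th c c' => [|n] th c c'; first by rewrite linear0.
by rewrite linear_sum; apply: eq_bigr => j _; rewrite linearZ.
Qed.

Lemma rdiffZ n (z y x : C) a (th : forall x, chain n y x -> hom C z x) c :
  rdiff (x := x) (fun x c => a *: th x c) c = a *: rdiff th c.
Proof.
have -> : (fun x (c : chain n y x) => a *: th x c) =
    (fun x c => comp (a *: idm z) (th x c)).
  apply: functional_extensionality_dep => w; apply/funext => d.
  by rewrite compZl comp1m.
by rewrite rdiff_comp compZl comp1m.
Qed.

Lemma rdiff0 n (z y x : C) (c : chain n.+1 y x) :
  rdiff (fun x (_ : chain n y x) => 0 : hom C z x) c = 0.
Proof.
have -> : (fun x (_ : chain n y x) => 0 : hom C z x) = (fun x _ => 0 *: 0).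
  apply: functional_extensionality_dep => w; apply/funext => d.
  by rewrite scale0r.
by rewrite rdiffZ scale0r.
Qed.

Lemma multilinear_comp n (v z y x : C) (g : hom C v z)
    (th : chain n y x -> hom C z x) :
  multilinear th -> multilinear (fun c => comp g (th c)).
Proof.
have H : forall n (y x : C) (th : chain n y x -> hom C z x), multilinear th ->
    multilinear (fun c => comp g (th c)).
  elim=> // {}n IH {}y {}x {}th mth w; split=> [c a f h|f].
    by rewrite (mth w).1 linearP.
  exact: IH _ _ _ ((mth w).2 f).
exact: H.
Qed.

Lemma multilinear0 n (V : lmodType k) (y x : C) :
  multilinear (fun _ : chain n y x => 0 : V).
Proof.
by elim: n y x => //= n IH y x w; split=> // c a f g; rewrite scaler0 addr0.
Qed.

Lemma multilinearD n (V : lmodType k) (y x : C) (th ze : chain n y x -> V) :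
  multilinear th -> multilinear ze -> multilinear (fun c => th c + ze c).
Proof.
move=> lth lze; have := multilinear_submod 1 lth lze.
by congr multilinear; apply/funext => c; rewrite scale1r.
Qed.

Lemma multilinearZ n (V : lmodType k) (y x : C) a (th : chain n y x -> V) :
  multilinear th -> multilinear (fun c => a *: th c).
Proof.
move=> lth; have := multilinear_submod a lth (@multilinear0 n V y x).
by congr multilinear; apply/funext => c; rewrite addr0.
Qed.

End ReducedDifferential.

(** * Cohomology when any path spans its hom space *)

Section Thin.
Variables (k : fieldType) (C : lincat k) (arr : C -> C -> Type).
Variable cls1 : forall y x, arr y x -> hom C y x.
Arguments cls1 {y x}.
Local Notation Q := (Quiver arr).

Fixpoint path_class (y x : vertex Q) (p : path y x) : hom C y x :=
  match p with
  | pnil x => idm (x : C)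
  | pcons _ _ _ a q => comp (cls1 a) (path_class q)
  end.
Local Notation cls := path_class.

Hypothesis acyclicQ : acyclic Q.
Hypothesis path_span : forall (y x : vertex Q) (p : path y x) (f : hom C y x),
  exists s, f = s *: cls p.
Hypothesis nopath_eq0 : forall y x : vertex Q,
  (path y x -> False) -> forall f : hom C y x, f = 0.

Lemma path_class_cat (z y x : vertex Q) (p : path z y) (q : path y x) :
  cls (pcat p q) = comp (cls p) (cls q).
Proof. by elim: p q => [w|w v u a p IH] q /=; rewrite ?comp1m ?IH ?compA. Qed.

Lemma linear_eq0 (V W : lmodType k) (F : V -> W) : linear F -> F 0 = 0.
Proof.
by move=> linF; have := linF (-1) 0 0; rewrite scaler0 add0r scaleN1r addNr.
Qed.

Lemma linear_scale (V W : lmodType k) (F : V -> W) a u :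
  linear F -> F (a *: u) = a *: F u.
Proof. by move=> linF; rewrite -[a *: u]addr0 linF linear_eq0 ?addr0. Qed.

(** Without a path from [x] to [y], some morphism of the chain lies in a zero hom space; a chain of
    length 0 is excluded by the trivial path. *)
Lemma multilinear_nopath_eq0 n (V : lmodType k) (y x : vertex Q)
    (th : chain n y x -> V) :
  (path y x -> False) -> multilinear th -> forall c, th c = 0.
Proof.
elim: n y x th => [|n IH] y x th np mth c.
  by exfalso; apply: np; case: _ / c; exact: pnil.
case: c => w [f c].
have [[p]|nyw] := pselect (inhabited (path y w)).
  apply: (IH w x (fun c => th (ccons f c)) _ ((mth w).2 f)) => q.
  exact/np/(pcat p q).
rewrite (nopath_eq0 _ f); last by move=> p; apply: nyw; exists.
exact: linear_eq0 ((mth w).1 c).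
Qed.

(** * Cocycles of degree at least 2 *)

Section HigherDegree.
Variables (m : nat) (phi : homfam C m.+2).
Hypothesis cphi : is_cochain phi.
Hypothesis dphi : diff phi = 0.

Lemma phi_linear1 (z y w x : C) (g : hom C y w) (c : chain m w x) :
  linear (fun f : hom C z y => phi (ccons f (ccons g c))).
Proof. by move=> a f h; rewrite (cphi _ _ _).1. Qed.

Lemma phi_linear2 (z y w x : C) (f : hom C z y) (c : chain m w x) :
  linear (fun g : hom C y w => phi (ccons f (ccons g c))).
Proof. by move=> a g h; rewrite ((cphi _ _ _).2 f _).1. Qed.

Lemma phi_multilinear (z y w x : C) (f : hom C z y) (g : hom C y w) :
  multilinear (fun c : chain m w x => phi (ccons f (ccons g c))).
Proof. exact: ((cphi _ _ _).2 f _).2. Qed.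

(** The cocycle identity, solved for the term from which [b] is to be split off. *)
Lemma cocycle_comp (z y w v x : C) (b : hom C z y) (g : hom C y w)
    (f : hom C w v) (c : chain m v x) :
  phi (ccons (comp b g) (ccons f c)) =
    comp b (phi (ccons g (ccons f c))) + phi (ccons b (ccons (comp g f) c))
    + rdiff (fun x (d : chain m w x) => phi (ccons b (ccons g d))) (ccons f c).
Proof.
have : diff phi (ccons b (ccons g (ccons f c))) = 0 by rewrite dphi.
rewrite diff_ccons !rdiff_ccons opprD !opprK; move: (rdiff _ _) => r.
rewrite !addrA => /eqP.
by rewrite [X in X == _](ACl (1*3*4*2)) /= subr_eq0 => /eqP <-.
Qed.

(* The sum of [u phi(b, v, c)] over all factorisations [p = u b v] with [b]   *)
(* an arrow.                                                                  *)
Fixpoint split_sum (z y : vertex Q) (p : path z y) :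
    forall x : C, chain m y x -> hom C z x :=
  match p with
  | pnil _ => fun _ _ => 0
  | pcons _ _ _ a q => fun x c =>
      phi (ccons (cls1 a) (ccons (cls q) c)) + comp (cls1 a) (split_sum q c)
  end.

Lemma split_sum_multilinear (z y : vertex Q) (p : path z y) x :
  multilinear (@split_sum z y p x).
Proof.
elim: p x => [w|w v u a q IH] x; first exact: multilinear0.
by apply: multilinearD; [exact: phi_multilinear|exact: multilinear_comp].
Qed.

(** This makes the sum well defined modulo I. If a path r from [x] to [y] exists, the values are
    multiples of the class of p r, which is 0; otherwise multilinearity makes them vanish. *)
Lemma split_sum_eq0 (z y : vertex Q) (p : path z y) x (c : chain m y x) :
  cls p = 0 -> split_sum p c = 0.
Proof.
move=> p0; have [[r]|nyx] := pselect (inhabited (path (Q := Q) y x)).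
  have [s ->] := path_span (pcat p r) (split_sum p c).
  by rewrite path_class_cat p0 comp0l scaler0.
apply: multilinear_nopath_eq0 c; last exact: split_sum_multilinear.
by move=> r; apply: nyx; exists.
Qed.

(** Linear extension through a chosen expression of [f] as a multiple of a path class. The default 0
    is taken only when no path exists, where the hom space is zero. *)
Definition split_sum_ext (z y : C) (f : hom C z y) x (c : chain m y x) :
    hom C z x :=
  match pselect (exists sp : k * path (Q := Q) z y, f = sp.1 *: cls sp.2) with
  | left h => let sp := projT1 (cid h) in sp.1 *: split_sum sp.2 c
  | right _ => 0
  end.
Local Notation D := split_sum_ext.

(** The choice is harmless: the path is unique, and so is the scalar unless the class of the path,
    and with it the sum, is 0. *)
Lemma split_sum_extE (z y : C) s (p : path (Q := Q) z y) x (c : chain m y x) :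
  D (s *: cls p) c = s *: split_sum p c.
Proof.
rewrite /split_sum_ext; case: pselect => [h|[]]; last by exists (s, p).
case: (cid h) => -[t q] /=; rewrite (acyclic_path_unique q p acyclicQ) => /eqP.
rewrite -subr_eq0 -scalerBl scaler_eq0 subr_eq0 => /orP[/eqP->//|/eqP p0].
by rewrite split_sum_eq0 // !scaler0.
Qed.

Lemma split_sum_ext_linear (z y : C) x (c : chain m y x) :
  linear (fun f : hom C z y => D f c).
Proof.
have [[p] a f g|nzy a f g] := pselect (inhabited (path (Q := Q) z y)).
  have [s ->] := path_span p f; have [t ->] := path_span p g.
  by rewrite scalerA -scalerDl !split_sum_extE scalerDl scalerA.
have D0 (h : hom C z y) : D h c = 0.
  rewrite /split_sum_ext; case: pselect => [h0|//].
  by exfalso; apply: nzy; case: h0 => -[s p] _; exact: inhabits p.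
by rewrite !D0 scaler0 addr0.
Qed.

Lemma split_sum_ext_multilinear (z y : C) (f : hom C z y) x :
  multilinear (@split_sum_ext z y f x).
Proof.
rewrite /split_sum_ext; case: pselect => h; last exact: multilinear0.
exact/multilinearZ/split_sum_multilinear.
Qed.

Lemma split_sum_ext_arrow (z y w : C) (a : arr z y) (f : hom C y w) x
    (c : chain m w x) :
  D (comp (cls1 a) f) c =
    phi (ccons (cls1 a) (ccons f c)) + comp (cls1 a) (D f c).
Proof.
have [[p]|nyw] := pselect (inhabited (path (Q := Q) y w)).
  have [s ->] := path_span p f.
  have -> : comp (cls1 a) (s *: cls p) = s *: cls (pcons (a : arrow Q z y) p).
    by rewrite linearZ.
  rewrite !split_sum_extE /=.
  by rewrite scalerDr (linear_scale _ _ (@phi_linear2 _ _ _ _ _ c)) linearZ.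
rewrite (nopath_eq0 _ f); last by move=> p; apply: nyw; exists.
rewrite linear0 !(linear_eq0 (@split_sum_ext_linear _ _ _ c)).
by rewrite (linear_eq0 (@phi_linear2 _ _ _ _ _ c)) linear0 addr0.
Qed.

(** The differential of -D is phi(p, f, c) - p phi(1, f, c). The term phi(1, -) repairs this defect,
    which is present when phi is not normalised. *)
Definition primitive : homfam C m.+1 := fun z x c =>
  phi (ccons (idm z) c) - (let: existT y (f, c') := c in D f c').

Lemma primitive_cochain : is_cochain primitive.
Proof.
move=> z x y; split=> [c a f g|f].
  rewrite /primitive /= split_sum_ext_linear phi_linear2.
  by rewrite scalerBr opprD addrACA.
have := multilinearZ (-1) (@split_sum_ext_multilinear z y f x).
move=> /(multilinearD (phi_multilinear x (idm z) f)); congr multilinear.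
by apply/funext => c; rewrite scaleN1r.
Qed.

(** Induction on [p]: for p = a q, the cocycle identity splits a off phi(a q, f, c), and what
    remains is a applied to the identity for q. *)
Lemma diff_split_sum (z y w : vertex Q) (p : path z y) (f : hom C y w) x
    (c : chain m w x) :
  comp (cls p) (D f c) - D (comp (cls p) f) c
    - rdiff (split_sum p) (ccons f c) =
  comp (cls p) (phi (ccons (idm y) (ccons f c)))
    - phi (ccons (cls p) (ccons f c)).
Proof.
elim: p f c => [u|u v t a p IH] f c /=.
  by rewrite !comp1m !subrr rdiff0 subr0.
rewrite -!compA split_sum_ext_arrow cocycle_comp rdiffD rdiff_comp.
move: (rdiff (fun x (d : chain m t x) => phi _) _) => r; rewrite !opprD !addrA.
have := congr1 (comp (cls1 a)) (IH f c); rewrite !linearB /= => aIH.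
rewrite [LHS](ACl (1*3*5*2*4)) /= aIH //.
Qed.

Lemma diff_split_sum_ext (z y w : C) (p : hom C z y) (f : hom C y w) x
    (c : chain m w x) :
  comp p (D f c) - D (comp p f) c - rdiff (@split_sum_ext z y p) (ccons f c) =
  comp p (phi (ccons (idm y) (ccons f c))) - phi (ccons p (ccons f c)).
Proof.
have [[q]|nzy] := pselect (inhabited (path (Q := Q) z y)).
  have [s ->] := path_span q p.
  rewrite !compZl (linear_scale _ _ (@split_sum_ext_linear _ _ _ c)).
  rewrite (linear_scale _ _ (@phi_linear1 _ _ _ _ _ c)).
  have -> : @split_sum_ext z y (s *: cls q) = (fun x d => s *: split_sum q d).
    apply: functional_extensionality_dep => u; apply/funext => d.
    exact: split_sum_extE.
  by rewrite rdiffZ -!scalerBr diff_split_sum.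
rewrite (nopath_eq0 _ p); last by move=> q; apply: nzy; exists.
have -> : @split_sum_ext z y 0 = (fun x _ => 0).
  apply: functional_extensionality_dep => u; apply/funext => d.
  exact: linear_eq0 (@split_sum_ext_linear _ _ _ d).
rewrite rdiff0 !comp0l (linear_eq0 (@split_sum_ext_linear _ _ _ c)).
by rewrite (linear_eq0 (@phi_linear1 _ _ _ _ _ c)) !subr0.
Qed.

Lemma diff_primitive : diff primitive = phi.
Proof.
apply: homfamP => z x [y [p [w [f c]]]].
rewrite -[existT _ _ _]/(ccons p (ccons f c)) diff_ccons rdiff_ccons.
have -> : (fun x d => primitive (ccons p d)) =
    (fun x (d : chain m y x) =>
       phi (ccons (idm z) (ccons p d)) + (-1) *: D p d).
  apply: functional_extensionality_dep => u; apply/funext => d.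
  by rewrite scaleN1r.
rewrite rdiffD rdiffZ scaleN1r /primitive /= linearB /=.
(* The cocycle identity with 1 as first argument shows that the differential of phi(1, -) at (p, f,
   c) is p phi(1, f, c). *)
have h1 := diff_split_sum_ext p f c; have h2 := cocycle_comp (idm z) p f c.
move: h1 h2; rewrite !comp1m; move: (rdiff _ _) (rdiff _ _) => r2 r1 h1.
rewrite -[LHS]addr0 -!addrA => /addrI/esym/eqP; rewrite addr_eq0 => /eqP->.
have -> : comp p (phi (ccons (idm y) (ccons f c))) =
    comp p (D f c) - D (comp p f) c - r1 + phi (ccons p (ccons f c)).
  by rewrite h1 subrK.
rewrite !opprD !opprK !addrA [LHS](ACl (4*(1*5)*(2*7)*(3*9)*(6*8)))/=.
by rewrite !subrr !addNr !addr0.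
Qed.

End HigherDegree.

(** * Derivations *)

Section DegreeOne.
Variable phi : homfam C 1.
Hypothesis cphi : is_cochain phi.
Hypothesis dphi : diff phi = 0.

Definition on_hom (y x : C) (f : hom C y x) : hom C y x :=
  phi (ccons (n := 0) f (erefl x)).

Lemma on_hom_linear y x : linear (@on_hom y x).
Proof. by move=> a f g; rewrite /on_hom (cphi _ _ _).1. Qed.

Lemma on_hom_derivation (z y x : C) (g : hom C z y) (f : hom C y x) :
  on_hom (comp g f) = comp g (on_hom f) + comp (on_hom g) f.
Proof.
have : diff phi (ccons g (ccons (n := 0) f (erefl x))) = 0 by rewrite dphi.
rewrite diff_ccons rdiff_ccons /rdiff /= add0r expr1 scaleN1r opprK => /eqP.
by rewrite addrCA addrC subr_eq0 => /eqP/esym.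
Qed.

(** The class of an arrow spans its hom space, so a derivation rescales it; by the Leibniz rule the
    scalars add up along a path, and their potential telescopes. *)
Lemma exists_scaling_potential : exists t : C -> k,
  forall y x (f : hom C y x), on_hom f = (t x - t y) *: f.
Proof.
have lamP (e : total_arrow Q) : exists s : k,
    on_hom (cls1 (tagged e)) = s *: cls1 (tagged e).
  have [s] := path_span (pcons (tagged e) (pnil _)) (on_hom (cls1 (tagged e))).
  by rewrite /= compm1; exists s.
have [lam lamE] := choice lamP.
have [t tP] := exists_potential lam acyclicQ; exists t.
have on_path (y x : vertex Q) (p : path y x) :
    on_hom (cls p) = (t x - t y) *: cls p.
  elim: p => [u|w v u a p IH] /=.
    (* A derivation kills identities. *)
    have := on_hom_derivation (idm u) (idm u).
    rewrite subrr scale0r !comp1m compm1 -[LHS]addr0 => /addrI.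
    exact: esym.
  rewrite on_hom_derivation IH linearZ /=.
  have := lamE (to_total (Q := Q) a).
  rewrite tP /= => ->; rewrite compZl -scalerDl.
  by rewrite addrA subrK.
move=> y x f; have [[p]|nyx] := pselect (inhabited (path (Q := Q) y x)).
  have [s ->] := path_span p f.
  by rewrite (linear_scale _ _ (@on_hom_linear _ _)) on_path !scalerA mulrC.
rewrite (nopath_eq0 _ f); last by move=> p; apply: nyx; exists.
by rewrite scaler0 (linear_eq0 (@on_hom_linear _ _)).
Qed.

Lemma diff_onto_degree1 : exists psi : homfam C 0, diff psi = phi.
Proof.
have [t tP] := exists_scaling_potential.
(* A 0-chain is a proof that its endpoints are equal, hence the transport of t(z) 1. *)
pose psi : homfam C 0 := fun z x e => eq_rect z (hom C z) (t z *: idm z) x e.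
exists psi; apply: homfamP => z x [y [f e]]; case: x / e.
rewrite -[existT _ _ _]/(ccons (n := 0) f (erefl y)) -/(on_hom f) tP.
rewrite diff_ccons /rdiff /= linearZ /= compm1 add0r expr1 scaleN1r.
by rewrite compZl comp1m scalerBl.
Qed.

End DegreeOne.

Lemma cocycle_coboundary n (phi : homfam C n.+1) :
  is_cochain phi -> diff phi = 0 -> @coboundaries k C n.+1 phi.
Proof.
case: n phi => [|n] phi cphi dphi.
  by have [psi <-] := diff_onto_degree1 cphi dphi; exists psi.
exists (primitive phi); first exact: primitive_cochain.
exact: diff_primitive.
Qed.

End Thin.

(** * Application to kQ/I *)

Lemma subquot_eq0 (k : pzRingType) (V : lmodType k) (Z B : set V)
    (subZ : submod_closed [in Z]) (subB : submod_closed [in B]) :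
  Z `<=` B -> forall u : subquot subZ subB, u = 0.
Proof.
move=> ZB u; rewrite -[u]lreprK; apply/(subquot_pi_eq0 subB)/ZB.
by case: (lrepr u) => v /= /set_mem.
Qed.

Theorem theorem5p11 (k : fieldType) (Q : quiver)
    (I : homset (path_cat k Q)) (idI : is_ideal I) :
  admissible I ->
  countable_cat (quotient_cat idI) ->
  locally_finite_dim (quotient_cat idI) ->
  is_tree (quotient_cat idI) ->
  forall n : nat, (1 <= n)%N ->
  forall u : HH (quotient_cat idI) n, u = 0%R.
Proof.
move=> admI _ _ /(tree_acyclic admI) acQ [//|n] _.
(* Opening [Q] makes its vertices, and those of [Quiver A], convertible with the objects of kQ/I. *)
case: Q I idI admI acQ => V A I idI admI acQ.
apply: subquot_eq0 => phi [cphi dphi].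
set C := quotient_cat idI in phi cphi dphi *.
pose arr (y x : C) : Type := A y x.
pose cls1 (y x : C) (a : arr y x) : hom C y x :=
  lpi (ideal_submod idI y x) (pbasis k (arrow_path (Q := Quiver A) a)).
have clsE (y x : C) (p : path (Q := Quiver A) y x) :
    path_class cls1 p = lpi (ideal_submod idI y x) (pbasis k p).
  elim: p => // z v u a p IH /=.
  rewrite IH; apply: etrans (qcomp_pi idI _ _) _.
  by congr lpi; exact: pcomp_basis.
apply: (@cocycle_coboundary k C arr cls1) => //.
- move=> y x p f; rewrite -[f]lreprK clsE [lrepr f]phomE.
  (* Every path in the support of the representative equals [p], so the scalars simply add up. *)
  exists (\sum_(q <- msupp (lrepr f)) (lrepr f)@_q).
  rewrite linear_sum scaler_suml; apply: eq_bigr => q _.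
  by rewrite linearZ (acyclic_path_unique q p acQ).
- move=> y x nyx f; rewrite -[f]lreprK [lrepr f]phomE.
  rewrite big1 ?linear0 // => q; by case: nyx.
Qed.
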